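(* Let $1\le k<d$, let $A=(A_n)_{n\in\mathbb Z}\in \mathcal L^{\rm Lya}(\mathbb Z,\mathbb R^{k\times k})$, $B=(B_n)_{n\in\mathbb Z}\in\mathcal L^{\rm Lya}(\mathbb Z,\mathbb R^{(d-k)\times(d-k)})$ and $C=(C_n)_{n\in\mathbb Z}\in\mathcal L^{\infty}(\mathbb Z,\mathbb R^{k\times(d-k)})$, and consider the system $x_{n+1}=D_nx_n$, $n\in\mathbb Z$, where \[ D_n=\begin{pmatrix}A_n & C_n\\ 0 & B_n\end{pmatrix}. \] Then \[ \Sigma^{\pm}_{\rm ED}(A)\cup\Sigma^{\pm}_{\rm ED}(B)\subset\Sigma_{\rm ED}(D)\subset\Sigma_{\rm ED}(A)\cup\Sigma_{\rm ED}(B), \] where $\Sigma^{\pm}_{\rm ED}(A):=\Sigma^{+}_{\rm ED}(A)\cup\Sigma^{-}_{\rm ED}(A)$ and $\Sigma^{\pm}_{\rm ED}(B):=\Sigma^{+}_{\rm ED}(B)\cup\Sigma^{-}_{\rm ED}(B)$.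
   Context: For $\mathbb T\in\{\mathbb Z,\mathbb Z_{\ge0},\mathbb Z_{\le0}\}$, $\mathcal L^{\infty}(\mathbb T,\mathbb R^{p\times q})$ is the set of bounded sequences $(M_n)_{n\in\mathbb T}$ of $p\times q$ real matrices; $\mathcal L^{\rm Lya}(\mathbb T,\mathbb R^{p\times p})$ is the set of $M\in\mathcal L^\infty(\mathbb T,\mathbb R^{p\times p})$ with every $M_n$ invertible and $(M_n^{-1})$ bounded. For $M\in\mathcal L^{\rm Lya}(\mathbb Z,\mathbb R^{p\times p})$ the evolution operator of $x_{n+1}=M_nx_n$ is $\Phi_M(m,n)=M_{m-1}\cdots M_n$ for $m>n$, $\Phi_M(n,n)=\mathrm{id}$, $\Phi_M(m,n)=M_m^{-1}\cdots M_{n-1}^{-1}$ for $m<n$. The system has an exponential dichotomy (ED) on $\mathbb T$ if there exist $K,\alpha>0$ and invariant projections $(P_n)_{n\in\mathbb T}$ ($P_m\Phi_M(m,n)=\Phi_M(m,n)P_n$) with $\|\Phi_M(m,n)P_n\|\le Ke^{-\alpha(m-n)}$ for $m\ge n$ and $\|\Phi_M(m,n)(\mathrm{id}-P_n)\|\le Ke^{\alpha(m-n)}$ for $m\le n$, $m,n\in\mathbb T$. Dichotomy spectra: $\Sigma_{\rm ED}(M)$, $\Sigma^+_{\rm ED}(M)$, $\Sigma^-_{\rm ED}(M)$ are the sets of $\gamma\in\mathbb R$ for which $x_{n+1}=e^{-\gamma}M_nx_n$ has no ED on $\mathbb Z$, $\mathbb Z_{\ge0}$, $\mathbb Z_{\le0}$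 respectively. *)

(* Defs.v *)
From mathcomp Require Import all_boot all_order all_algebra.
From mathcomp Require Import classical_sets reals sequences exp.
Set Implicit Arguments. Unset Strict Implicit. Unset Printing Implicit Defensive.
Import Order.TTheory GRing.Theory Num.Theory.
Local Open Scope ring_scope.

(* Matrix norm: max of absolute values of entries.  All norms on a
   finite-dimensional space are equivalent, so the notions below
   (boundedness, exponential dichotomy) do not depend on this choice. *)
Definition mxnorm (R : realType) (p q : nat) (M : 'M[R]_(p, q)) : R :=
  \big[Num.max/0]_(i < p) \big[Num.max/0]_(j < q) `|M i j|.

Definition bounded_seq (R : realType) (p q : nat) (M : int -> 'M[R]_(p, q)) : Prop :=
  exists c : R, forall n : int, mxnorm (M n) <= c.

Definition lya_seq (R : realType) (p : nat) (M : int -> 'M[R]_p) : Prop :=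
  bounded_seq M /\ (forall n : int, M n \in unitmx) /\
  bounded_seq (fun n => invmx (M n)).

Fixpoint Phi_fwd (R : realType) (p : nat) (M : int -> 'M[R]_p) (n : int) (k : nat)
  : 'M[R]_p :=
  match k with
  | O => 1%:M
  | S k' => M (n + k'%:Z) *m Phi_fwd M n k'
  end.

Fixpoint Phi_bwd (R : realType) (p : nat) (M : int -> 'M[R]_p) (n : int) (k : nat)
  : 'M[R]_p :=
  match k with
  | O => 1%:M
  | S k' => invmx (M (n - k'%:Z - 1)) *m Phi_bwd M n k'
  end.

Definition Phi (R : realType) (p : nat) (M : int -> 'M[R]_p) (m n : int) : 'M[R]_p :=
  if n <= m then Phi_fwd M n `|m - n|%N else Phi_bwd M n `|m - n|%N.

Definition TZ : int -> Prop := fun _ => True.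
Definition TZge0 : int -> Prop := fun n => 0 <= n.
Definition TZle0 : int -> Prop := fun n => n <= 0.

Definition has_ED (R : realType) (p : nat) (T : int -> Prop) (M : int -> 'M[R]_p) : Prop :=
  exists (K alpha : R) (P : int -> 'M[R]_p),
    0 < K /\ 0 < alpha /\
    (forall n, T n -> P n *m P n = P n) /\
    (forall m n, T m -> T n -> P m *m Phi M m n = Phi M m n *m P n) /\
    (forall m n, T m -> T n -> n <= m ->
       mxnorm (Phi M m n *m P n) <= K * expR (- alpha * (m - n)%:~R)) /\
    (forall m n, T m -> T n -> m <= n ->
       mxnorm (Phi M m n *m (1%:M - P n)) <= K * expR (alpha * (m - n)%:~R)).

Definition Sigma_ED (R : realType) (p : nat) (T : int -> Prop) (M : int -> 'M[R]_p) : set R :=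
  [set gamma | ~ has_ED T (fun n => expR (- gamma) *: M n)].

Definition SigmaZ (R : realType) (p : nat) (M : int -> 'M[R]_p) := Sigma_ED TZ M.
Definition SigmaPlus (R : realType) (p : nat) (M : int -> 'M[R]_p) := Sigma_ED TZge0 M.
Definition SigmaMinus (R : realType) (p : nat) (M : int -> 'M[R]_p) := Sigma_ED TZle0 M.

(* Main.v *)
(** Let [F] be the fundamental matrix of a system with [F 0 = 1].  A dichotomy is
    one constant projection [P] for which [F_m P F_n^-1] decays as [m - n] grows
    and [F_m (1 - P) F_n^-1] decays as [n - m] grows; replacing [F_n] by [F_(-n)]
    and [P] by [1 - P] reverses time, so every estimate is needed only once.

    If [D] has a dichotomy on [Z], restrict it to [Z_(>=0)].  There only the range
    of the projection matters, and some projection with the same range leaves the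
    invariant subspace [R^k x 0] invariant; being block triangular, it has diagonal
    blocks giving dichotomies of [A] and [B].  Time reversal handles [Z_(<=0)].

    Conversely, write the fundamental matrix of [D] as [(F, F W; 0, G)], where
    [W_(n+1) - W_n = F_(n+1)^-1 C_n G_n].  Given the projections [P] and [Q] of [A]
    and [B], the limits [L1] of [P W_n (1 - Q)] at [-oo] and [L2] of [(1 - P) W_n Q]
    at [+oo] exist, and [(P, P L1 (1 - Q) - (1 - P) L2 Q; 0, Q)] is a projection
    giving a dichotomy of [D]. *)
Require Import Defs.
From mathcomp Require Import all_boot all_order all_algebra.
From mathcomp Require Import zify ring lra.
From mathcomp Require Import classical_sets boolp reals sequences exp.
Import Order.TTheory GRing.Theory Num.Theory.
Local Open Scope ring_scope.
Local Open Scope classical_set_scope.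

Set Implicit Arguments.
Unset Strict Implicit.
Unset Printing Implicit Defensive.

(** * A submultiplicative norm equivalent to [mxnorm] *)

Section EntrywiseL1Norm.
Variable R : realType.

Definition nrm p q (M : 'M[R]_(p, q)) : R := \sum_i \sum_j `|M i j|.

Lemma nrm_ge0 p q (M : 'M[R]_(p, q)) : 0 <= nrm M.
Proof. by apply: sumr_ge0 => i _; apply: sumr_ge0. Qed.

Lemma nrmD p q (M N : 'M[R]_(p, q)) : nrm (M + N) <= nrm M + nrm N.
Proof.
rewrite /nrm -big_split; apply: ler_sum => i _; rewrite -big_split /=.
by apply: ler_sum => j _; rewrite mxE ler_normD.
Qed.

Lemma nrmN p q (M : 'M[R]_(p, q)) : nrm (- M) = nrm M.
Proof. by apply: eq_bigr => i _; apply: eq_bigr => j _; rewrite mxE normrN. Qed.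

Lemma nrmZ p q (a : R) (M : 'M[R]_(p, q)) : nrm (a *: M) = `|a| * nrm M.
Proof.
rewrite /nrm mulr_sumr; apply: eq_bigr => i _; rewrite mulr_sumr.
by apply: eq_bigr => j _; rewrite mxE normrM.
Qed.

Lemma nrm_sum p q n (M : 'I_n -> 'M[R]_(p, q)) :
  nrm (\sum_i M i) <= \sum_i nrm (M i).
Proof.
elim/big_ind2: _ => [|x1 x2 y1 y2 h1 h2|//].
  by rewrite /nrm big1 // => i _; rewrite big1 // => j _; rewrite mxE normr0.
exact: le_trans (nrmD _ _) (lerD h1 h2).
Qed.

Lemma entry_le_nrm p q (M : 'M[R]_(p, q)) i j : `|M i j| <= nrm M.
Proof.
rewrite /nrm (bigD1 i) //= (bigD1 j) //= -addrA lerDl addr_ge0 ?sumr_ge0 //.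
by move=> k _; apply: sumr_ge0.
Qed.

Lemma nrmM p q s (M : 'M[R]_(p, q)) (N : 'M[R]_(q, s)) :
  nrm (M *m N) <= nrm M * nrm N.
Proof.
rewrite [nrm M]/nrm mulr_suml; apply: ler_sum => i _.
have le1 j : `|(M *m N) i j| <= \sum_k `|M i k| * `|N k j|.
  rewrite mxE; apply: le_trans (ler_norm_sum _ _ _) _.
  by apply: ler_sum => k _; rewrite normrM.
apply: le_trans (ler_sum _ (fun j _ => le1 j)) _.
rewrite exchange_big /= mulr_suml; apply: ler_sum => k _.
rewrite -mulr_sumr ler_wpM2l // /nrm (bigD1 k) //= lerDl.
by apply: sumr_ge0 => l _; apply: sumr_ge0.
Qed.

Lemma nrmM_le p q s (M : 'M[R]_(p, q)) (N : 'M[R]_(q, s)) a b :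
  nrm M <= a -> nrm N <= b -> nrm (M *m N) <= a * b.
Proof.
by move=> ha hb; apply: le_trans (nrmM _ _) _; apply: ler_pM; rewrite ?nrm_ge0.
Qed.

Lemma entry_le_mxnorm p q (M : 'M[R]_(p, q)) i j : `|M i j| <= mxnorm M.
Proof.
rewrite /mxnorm; apply: le_trans (le_bigmax _ _ i).
exact: (le_bigmax _ (fun j => `|M i j|)).
Qed.

Lemma mxnorm_le_nrm p q (M : 'M[R]_(p, q)) : mxnorm M <= nrm M.
Proof.
apply: bigmax_le => [|i _]; first exact: nrm_ge0.
by apply: bigmax_le => [|j _]; rewrite ?nrm_ge0 ?entry_le_nrm.
Qed.

Lemma nrm_le_mxnorm p q (M : 'M[R]_(p, q)) : nrm M <= (p * q)%:R * mxnorm M.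
Proof.
have le1 i : \sum_j `|M i j| <= \sum_(j < q) mxnorm M.
  by apply: ler_sum => j _; apply: entry_le_mxnorm.
apply: le_trans (ler_sum _ (fun i _ => le1 i)) _.
by rewrite !sumr_const !card_ord -mulrnA mulnC mulr_natl.
Qed.

Lemma nrm_block k l (a : 'M[R]_k) b c (e : 'M[R]_l) :
  nrm (block_mx a b c e) = nrm a + nrm b + (nrm c + nrm e).
Proof.
rewrite /nrm big_split_ord /= -!big_split /=; congr (_ + _);
  apply: eq_bigr => i _; rewrite big_split_ord /=; congr (_ + _);
  by apply: eq_bigr => j _;
    rewrite (block_mxEul, block_mxEur, block_mxEdl, block_mxEdr).
Qed.

End EntrywiseL1Norm.

(** * Fundamental matrices and dichotomies given by one constant projection *)

Section FundamentalMatrix.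
Variable R : realType.

Definition fundamental p (M F : int -> 'M[R]_p) : Prop :=
  [/\ F 0 = 1%:M, forall n, F n \in unitmx & forall n, F (n + 1) = M n *m F n].

Lemma fundamental_exists p (M : int -> 'M[R]_p) :
  (forall n, M n \in unitmx) -> exists F, fundamental M F.
Proof.
move=> uM.
(* [Negz k] stands for [- (k + 1)], hence the [k.+1] backward steps. *)
pose F (n : int) := if n is Negz k then Phi_bwd M 0 k.+1 else Phi_fwd M 0 `|n|.
have uf k : Phi_fwd M 0 k \in unitmx.
  by elim: k => [|k IH] /=; rewrite ?unitmx1 // unitmx_mul uM.
have ub k : Phi_bwd M 0 k \in unitmx.
  by elim: k => [|k IH] /=; rewrite ?unitmx1 // unitmx_mul unitmx_inv uM.
exists F; split=> // [[k|k]|[k|k]]; [exact: uf|exact: ub| |].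
  by rewrite -PoszD addn1 /= add0r.
have -> : Negz k + 1 = - k%:Z by rewrite NegzE; lia.
have -> : F (- k%:Z) = Phi_bwd M 0 k by case: k.
rewrite /F /= sub0r.
have -> : - k%:Z - 1 = Negz k by rewrite NegzE; lia.
by rewrite mulKVmx.
Qed.

Lemma Phi_fundamental p (M F : int -> 'M[R]_p) :
  (forall n, M n \in unitmx) -> fundamental M F ->
  forall m n, Phi M m n = F m *m invmx (F n).
Proof.
move=> uM [_ uF rF] m n.
have hf k : Phi_fwd M n k = F (n + k%:Z) *m invmx (F n).
  elim: k => [|k IH] /=; first by rewrite addr0 mulmxV.
  by rewrite IH mulmxA -rF -addrA -PoszD addn1.
have hb k : Phi_bwd M n k = F (n - k%:Z) *m invmx (F n).
  elim: k => [|k IH] /=; first by rewrite subr0 mulmxV.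
  rewrite IH mulmxA; congr (_ *m _).
  have -> : n - k%:Z = n - k.+1%:Z + 1 by lia.
  have -> : n - k.+1%:Z + 1 - 1 = n - k.+1%:Z by lia.
  by rewrite rF mulKmx.
rewrite /Phi; case: leP => h; rewrite ?hf ?hb; congr (F _ *m _); lia.
Qed.

(** The conjugate of [P] by [F n] is the invariant projection at time [n], so the matrix measured
    here is the evolution over [t] steps applied to it; [r] stands for the exponential of
    [- alpha]. *)
Definition decays p (T : int -> Prop) (F : int -> 'M[R]_p) (P : 'M[R]_p)
    (K r : R) :=
  forall n (t : nat), T n -> T (n + t%:Z) ->
    nrm (F (n + t%:Z) *m P *m invmx (F n)) <= K * r ^+ t.

(* The growth condition on the kernel of [P] is decay for reversed time. *)
Definition dichotomy p (T : int -> Prop) (F : int -> 'M[R]_p) (P : 'M[R]_p)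
    (K r : R) :=
  [/\ 0 <= K, 0 < r < 1, P *m P = P, decays T F P K r &
      decays (T \o -%R) (F \o -%R) (1%:M - P) K r].

Lemma idem_compl p (P : 'M[R]_p) :
  P *m P = P -> (1%:M - P) *m (1%:M - P) = 1%:M - P.
Proof.
by move=> e; rewrite mulmxBr mulmx1 mulmxBl mul1mx e subrr subr0.
Qed.

Lemma dichotomy_rev p (T : int -> Prop) (F : int -> 'M[R]_p) P (K r : R) :
  dichotomy T F P K r -> dichotomy (T \o -%R) (F \o -%R) (1%:M - P) K r.
Proof.
case=> K0 r01 PP d1 d2; split=> //; first exact: idem_compl.
move=> n t /=; rewrite !opprK => Tn Tnt; rewrite subKr; exact: d1.
Qed.

Lemma dichotomy_revK p (T : int -> Prop) (F : int -> 'M[R]_p) P (K r : R) :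
  dichotomy (T \o -%R) (F \o -%R) P K r -> dichotomy T F (1%:M - P) K r.
Proof.
case=> K0 r01 PP d1 d2; split=> //; first exact: idem_compl.
  by move=> n t Tn Tnt; have := d2 n t; rewrite /= !opprK; apply.
by rewrite subKr.
Qed.

Lemma expR_decay (alpha : R) (t : nat) :
  expR (- alpha * t%:R) = expR (- alpha) ^+ t.
Proof. by rewrite mulrC expRM_natl. Qed.

(** Invariance between times [n] and [0] forces [P n] to be the conjugate of [P 0] by [F n], so the
    projection at time 0 carries all the information. The factor [p * p] comes from comparing the
    two norms. *)
Lemma has_ED_dichotomy p (T : int -> Prop) (M F : int -> 'M[R]_p) :
  T 0 -> (forall n, M n \in unitmx) -> fundamental M F ->
  has_ED T M <-> exists P K r, dichotomy T F P K r.
Proof.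
move=> T0 uM fF; have PhiE := Phi_fundamental uM fF; case: fF => F0 uF _.
split=> [[K [alpha [P [K0 [a0 [PP [inv [dP dQ]]]]]]]]|].
  have PE n : T n -> P n = F n *m P 0 *m invmx (F n).
    move=> Tn; have := inv _ _ Tn T0; rewrite PhiE F0 invmx1 mulmx1 => <-.
    by rewrite mulmxK.
  exists (P 0), ((p * p)%:R * K), (expR (- alpha)); split.
  - by rewrite mulr_ge0 // ltW.
  - by rewrite expR_gt0 expR_lt1 oppr_lt0.
  - exact: PP.
  - move=> n t Tn Tnt; apply: le_trans (nrm_le_mxnorm _) _.
    rewrite -mulrA ler_wpM2l // -expR_decay.
    have := dP _ _ Tnt Tn; rewrite lerDl => /(_ isT).
    by rewrite PhiE PE // !mulmxA mulmxKV // [n + _]addrC addrK.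
  - move=> n t /= Tn Tnt; apply: le_trans (nrm_le_mxnorm _) _.
    rewrite -mulrA ler_wpM2l // -expR_decay.
    have := dQ _ _ Tnt Tn; rewrite opprD gerDl oppr_le0 => /(_ isT).
    rewrite PhiE PE // !mulmxBr !mulmxBl !mulmxA mulmx1 mulmxKV //.
    rewrite mulmx1; have -> : - n - t%:Z - - n = - t%:Z by lia.
    by rewrite mulrNz mulrN mulNr.
move=> [P [K [r [K0 /andP[r0 r1] PP d1 d2]]]].
(* [dichotomy] admits [K = 0], whereas [has_ED] asks for a positive constant. *)
exists (K + 1), (- ln r), (fun n => F n *m P *m invmx (F n)).
have rE (t : nat) : expR (- - ln r * t%:R) = r ^+ t by rewrite expR_decay opprK lnK.
have rt0 t : 0 <= r ^+ t by rewrite exprn_ge0 // ltW.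
have K1 t : K * r ^+ t <= (K + 1) * r ^+ t by rewrite ler_wpM2r // lerDl.
split; first by rewrite ltr_wpDl.
split; first by rewrite oppr_gt0 ln_lt0 // r0.
split; first by move=> n _; rewrite !mulmxA mulmxKV // -[_ *m P *m P]mulmxA PP.
split; first by move=> m n _ _; rewrite PhiE !mulmxA !mulmxKV.
split=> m n Tm Tn le; apply: le_trans (mxnorm_le_nrm _) _.
  have [t mE] : exists t : nat, m = n + t%:Z by exists `|m - n|%N; lia.
  rewrite {m le}mE in Tm *; rewrite addrAC subrr add0r rE; apply: le_trans (K1 _).
  by rewrite PhiE !mulmxA mulmxKV //; apply: d1.
have [t nE] : exists t : nat, n = m + t%:Z by exists `|m - n|%N; lia.
rewrite {n le}nE in Tn *; have -> : m - (m + t%:Z) = - t%:Z by lia.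
rewrite mulrNz mulrN -mulNr rE; apply: le_trans (K1 _).
have := d2 (- (m + t%:Z)) t; rewrite /= opprK.
have -> : - (- (m + t%:Z) + t%:Z) = m by lia.
move/(_ Tn Tm); congr (nrm _ <= _).
by rewrite PhiE !mulmxBr !mulmxBl !mulmxA !mulmx1 mulmxKV.
Qed.

End FundamentalMatrix.

(** * Block triangular projections and dichotomies on a half-line *)

Section BlockTriangular.
Variable R : realType.

Lemma block_unitmx k l (a : 'M[R]_k) b (e : 'M[R]_l) :
  a \in unitmx -> e \in unitmx -> block_mx a b 0 e \in unitmx.
Proof. by rewrite !unitmxE det_ublock unitrM => -> ->. Qed.

Lemma invmx_block k l (a : 'M[R]_k) b (e : 'M[R]_l) :
  a \in unitmx -> e \in unitmx ->
  invmx (block_mx a b 0 e) =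
  block_mx (invmx a) (- (invmx a *m b *m invmx e)) 0 (invmx e).
Proof.
move=> ua ue; have uab := block_unitmx b ua ue.
apply: (can_inj (mulKmx uab)); rewrite mulmxV // mulmx_block.
by rewrite !mulmx0 !mul0mx !addr0 add0r !mulmxN !mulmxA !mulmxV // mul1mx
  addNr -scalar_mx_block.
Qed.

Lemma compl_block k l (a : 'M[R]_k) b (e : 'M[R]_l) :
  1%:M - block_mx a b 0 e = block_mx (1%:M - a) (- b) 0 (1%:M - e).
Proof. by rewrite scalar_mx_block opp_block_mx add_block_mx oppr0 addr0 add0r. Qed.

(* [P' = P + P Z (1 - P)] has the same range as [P] for every [Z]; killing its
   lower-left block amounts to solving [a Z b = c], where [c] factors both
   through [a] and through [b], so that generalized inverses give a solution. *)
Lemma block_projection (K : fieldType) k l (P : 'M[K]_(k + l)) :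
  P *m P = P ->
  exists P', [/\ P' *m P' = P', P *m P' = P', P' *m P = P & dlsubmx P' = 0].
Proof.
move=> PP.
pose J : 'M[K]_(l, k + l) := row_mx 0 1%:M.
pose I : 'M[K]_(k + l, k) := col_mx 1%:M 0.
have dlE (M : 'M[K]_(k + l)) : dlsubmx M = J *m M *m I.
  rewrite -[M in RHS]submxK mul_row_block mul_row_col !mul0mx !mul1mx !add0r.
  by rewrite mulmx1 mulmx0 addr0.
have JI : J *m I = 0 by rewrite mul_row_col mul0mx mulmx0 addr0.
have [a aE] : exists a, a = J *m P by exists (J *m P).
have [b bE] : exists b, b = (1%:M - P) *m I by exists ((1%:M - P) *m I).
have ginv m n (M : 'M[K]_(m, n)) : exists M', M *m M' *m M = M.
  by exists (pinvmx M); rewrite mulmxKpV.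
have [a' aK] := ginv _ _ a; have [b' bK] := ginv _ _ b.
have [Z aZb] : exists Z, a *m Z *m b = - (a *m I).
  exists (a' *m (- (a *m I)) *m b').
  (* As [J *m I = 0], the right-hand side starts with the factor [a] and also ends with the factor
     [b], so both generalized inverses cancel. *)
  have aI : - (a *m I) = J *m b.
    by rewrite aE bE mulmxA mulmxBr mulmx1 mulmxBl JI sub0r.
  have -> : a *m (a' *m (- (a *m I)) *m b') = - (a *m I) *m b'.
    by rewrite !mulmxA mulmxN mulmxA aK.
  by rewrite aI -!mulmxA [b *m _]mulmxA bK.
exists (P + P *m Z *m (1%:M - P)); set P' := P + _.
have PP' : P *m P' = P' by rewrite [LHS]mulmxDr PP !mulmxA PP.
have P'P : P' *m P = P.
  by rewrite [LHS]mulmxDl PP -mulmxA mulmxBl mul1mx PP subrr mulmx0 addr0.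
split=> //; first by rewrite -{2}PP' mulmxA P'P PP'.
by rewrite dlE mulmxDr mulmxDl !mulmxA -aE -[a *m Z *m _ *m I]mulmxA -bE aZb subrr.
Qed.

(* On a half-line only the range of the projection matters. *)
Lemma dichotomy_same_range p (F : int -> 'M[R]_p) P P' (K r : R) :
  F 0 = 1%:M -> P' *m P' = P' -> P *m P' = P' -> P' *m P = P ->
  dichotomy TZge0 F P K r -> exists K', dichotomy TZge0 F P' K' r.
Proof.
move=> F0 P'P' PP' P'P [K0 r01 PP d1 d2]; have /andP[r0 r1] := r01.
(* The difference vanishes on the range of [P] and takes values in it. Its conjugate between times
   [m] and [n] therefore picks up decay from 0 to [m] and from [n] back to 0, a factor
   [r ^+ (m + n)], which on the half-line is at most [r] to the distance of the two times. *)
have diffE : P' - P = P *m (P' - P) *m (1%:M - P).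
  by rewrite [P *m _]mulmxBr PP' PP mulmxBr mulmx1 mulmxBl P'P PP subrr subr0.
pose c := nrm (P' - P).
have fwd (n : nat) : nrm (F n *m P) <= K * r ^+ n.
  by have := d1 0 n isT; rewrite add0r F0 invmx1 mulmx1; apply.
have bwd (n : nat) : nrm ((1%:M - P) *m invmx (F n)) <= K * r ^+ n.
  have := d2 (- n%:Z) n; rewrite /= addNr oppr0 opprK F0 mul1mx.
  by apply; rewrite /TZge0.
have corr (m n t : nat) : (t <= m + n)%N ->
  nrm (F m *m (P' - P) *m invmx (F n)) <= K * c * K * r ^+ t.
  move=> tmn; rewrite diffE !mulmxA -mulmxA.
  apply: le_trans (nrmM_le (nrmM_le (fwd m) (lexx _)) (bwd n)) _.
  have -> : K * r ^+ m * c * (K * r ^+ n) = K * c * K * r ^+ (m + n).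
    by rewrite exprD; ring.
  rewrite ler_wpM2l ?mulr_ge0 ?nrm_ge0 //.
  by apply: ler_wiXn2l => //; apply: ltW.
exists (K + K * c * K); split=> //.
- by rewrite addr_ge0 ?mulr_ge0 ?nrm_ge0.
- move=> n t Tn Tnt; have -> : P' = P + (P' - P) by rewrite addrC subrK.
  rewrite mulmxDr mulmxDl mulrDl; apply: le_trans (nrmD _ _) _.
  apply: lerD; first exact: d1.
  case: n Tn Tnt => // n _ _; rewrite -PoszD; apply: corr; lia.
- move=> n t Tn Tnt.
  have -> : 1%:M - P' = 1%:M - P - (P' - P) by rewrite opprB addrA subrK.
  rewrite mulmxBr mulmxBl mulrDl; apply: le_trans (nrmD _ _) _.
  apply: lerD; first exact: d2.
  rewrite nrmN /=; move: Tn Tnt; rewrite /= /TZge0 => Tn Tnt.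
  have [m mE] : exists m : nat, - n = m%:Z by exists `|n|%N; lia.
  have [m' m'E] : exists m : nat, - (n + t%:Z) = m%:Z by exists (`|n|%N - t)%N; lia.
  by rewrite mE m'E; apply: corr; lia.
Qed.

(** Products and inverses of block upper triangular matrices are computed blockwise on the diagonal,
    and [nrm] of a diagonal block is at most that of the whole matrix. *)
Lemma decays_diag k l (T : int -> Prop) (F : int -> 'M[R]_k) (G : int -> 'M[R]_l)
    Y a b e (K r : R) :
  (forall n, F n \in unitmx) -> (forall n, G n \in unitmx) ->
  decays T (fun n => block_mx (F n) (Y n) 0 (G n)) (block_mx a b 0 e) K r ->
  decays T F a K r /\ decays T G e K r.
Proof.
have diag_le (u : 'M[R]_k) v w (z : 'M[R]_l) :
    nrm u <= nrm (block_mx u v w z) /\ nrm z <= nrm (block_mx u v w z).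
  rewrite nrm_block.
  have := (nrm_ge0 u, nrm_ge0 v, nrm_ge0 w, nrm_ge0 z) => -[[[]]].
  by split; lra.
move=> uF uG d; split=> n t Tn Tnt; apply: le_trans (d n t Tn Tnt);
  rewrite invmx_block // !mulmx_block !mul0mx !mulmx0 !addr0 !add0r
    !(mul0mx, add0r).
  exact: (diag_le _ _ _ _).1.
exact: (diag_le _ _ _ _).2.
Qed.

Lemma dichotomy_diag k l (F : int -> 'M[R]_k) (G : int -> 'M[R]_l) Y P (K r : R) :
  let H n := block_mx (F n) (Y n) 0 (G n) in
  (forall n, F n \in unitmx) -> (forall n, G n \in unitmx) ->
  H 0 = 1%:M -> dichotomy TZge0 H P K r ->
  (exists P K r, dichotomy TZge0 F P K r) /\
  (exists P K r, dichotomy TZge0 G P K r).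
Proof.
move=> H uF uG H0 dH; have PP : P *m P = P by case: dH.
have [P' [P'P' PP' P'P dl0]] := block_projection PP.
have [K' [K'0 r01 _ d1 d2]] := dichotomy_same_range H0 P'P' PP' P'P dH.
have PE : P' = block_mx (ulsubmx P') (ursubmx P') 0 (drsubmx P').
  by rewrite -dl0 submxK.
move: P'P'; rewrite PE mulmx_block !mul0mx !mulmx0 !addr0 !add0r.
move=> /eq_block_mx[PPa _ _ PPe].
move: d1 d2; rewrite PE compl_block => d1 d2.
have [d1a d1e] := decays_diag uF uG d1.
have [d2a d2e] := @decays_diag _ _ _ (F \o -%R) (G \o -%R) (Y \o -%R) _ _ _ _ _
  (fun n => uF (- n)) (fun n => uG (- n)) d2.
by split; [exists (ulsubmx P') | exists (drsubmx P')]; exists K', r.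
Qed.

End BlockTriangular.

(** * Geometric sums, limits of matrix sequences and antidifferences *)

Section Estimates.
Variable R : realType.

(** Factor [x ^+ t - y ^+ t] by [x - y]; raising the exponent of [y] from [t.-1 - i] to [t - i] only
    shrinks the terms. The gap [y < x] keeps the convolution at rate [x], with no factor growing in
    [t]. *)
Lemma sum_geometric_le (x y : R) (t : nat) : 0 <= y -> y < x -> x <= 1 ->
  \sum_(i < t) y ^+ (t - i) * x ^+ i <= x ^+ t / (x - y).
Proof.
move=> y0 yx x1; have xy0 : 0 < x - y by rewrite subr_gt0.
have x0 : 0 <= x by lra.
rewrite ler_pdivlMr // mulrC.
have -> : x ^+ t = (x - y) * (\sum_(i < t) y ^+ (t.-1 - i) * x ^+ i) + y ^+ t.
  by have := subrXX y x t; lra.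
apply: ler_wpDr; first exact: exprn_ge0.
rewrite ler_wpM2l ?(ltW xy0) //; apply: ler_sum => i _.
rewrite ler_wpM2r ?exprn_ge0 //; apply: ler_wiXn2l => //; first by lra.
by have := ltn_ord i; lia.
Qed.

(** Follows from [1 + x <= expR x] at [x = - N ln s]; the bound [N0] lets [N] be taken beyond a
    prescribed time. *)
Lemma exists_small_pow (a s : R) (N0 : nat) : 0 < s < 1 ->
  exists2 N : nat, (N0 <= N)%N & a * s ^+ N <= 1.
Proof.
move=> s01; have /andP[s0 _] := s01.
have y0 : 0 < - ln s by rewrite oppr_gt0 ln_lt0.
exists (maxn N0 (Num.bound `|a / - ln s|)); first exact: leq_maxl.
set N := maxn _ _.
have aN : a <= N%:R * - ln s.
  rewrite -ler_pdivrMr //; apply: le_trans (ler_norm _) _.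
  apply: ltW; apply: lt_le_trans (archi_boundP (normr_ge0 _)) _.
  by rewrite ler_nat leq_maxr.
rewrite -ler_pdivlMr ?exprn_gt0 // div1r.
have -> : (s ^+ N)^-1 = expR (N%:R * - ln s).
  by rewrite expRM_natl expRN lnK // exprVn.
by apply: le_trans (expR_ge1Dx _); rewrite ler_wpDl.
Qed.

(** The supremum of the lower bounds [u M - e M] serves as the limit: each of them lies below every
    upper bound [u N + e N]. *)
Lemma sup_tail_bound (u e : nat -> R) :
  (forall N t, `|u (N + t)%N - u N| <= e N) ->
  forall N, `|sup [set u M - e M | M in setT] - u N| <= e N.
Proof.
move=> h; set E := [set _ | _ in _].
have ub M N : u M - e M <= u N + e N.
  have [e0 e0'] : 0 <= e M /\ 0 <= e N.
    by split; [apply: le_trans (h M 0%N)|apply: le_trans (h N 0%N)].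
  by case: (leqP M N) => MN;
    [have := h M (N - M)%N|have := h N (M - N)%N];
    rewrite subnKC ?(ltnW MN) // ler_norml => /andP[]; lra.
have E0 : E !=set0 by exists (u 0%N - e 0%N), 0%N.
have ubE N : ubound E (u N + e N) by move=> _ [M _ <-].
move=> N; have h1 : sup E <= u N + e N by apply: ge_sup.
have h2 : u N - e N <= sup E.
  by apply: ub_le_sup; [exists (u 0%N + e 0%N)|exists N].
by rewrite ler_norml; apply/andP; split; lra.
Qed.

Lemma mx_limit p q (u : nat -> 'M[R]_(p, q)) (e : nat -> R) :
  (forall N t, nrm (u (N + t)%N - u N) <= e N) ->
  exists L, forall N, nrm (L - u N) <= (p * q)%:R * e N.
Proof.
move=> h; exists (\matrix_(i, j) sup [set u M i j - e M | M in setT]) => N.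
pose L := \matrix_(i, j) sup [set u M i j - e M | M in setT].
have le1 i j : `|(L - u N) i j| <= e N.
  rewrite !mxE; apply: (sup_tail_bound (u := fun M => u M i j)) => M t.
  by have := entry_le_nrm (u (M + t)%N - u M) i j; rewrite !mxE => /le_trans; apply.
rewrite /nrm.
apply: le_trans (ler_sum _ (fun i _ => ler_sum _ (fun j _ => le1 i j))) _.
by rewrite !sumr_const !card_ord -mulrnA mulnC mulr_natl.
Qed.

Lemma antidifference (V : zmodType) (w : int -> V) :
  exists W : int -> V, forall n, W (n + 1) - W n = w n.
Proof.
pose W (n : int) := if n is Negz k then - \sum_(i < k.+1) w (Negz i)
                    else \sum_(i < `|n|%N) w i%:Z.
exists W => -[k|k]; first by
  rewrite -PoszD addn1 /= big_ord_recr /= addrAC subrr add0r.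
have -> : Negz k + 1 = - k%:Z by rewrite NegzE; lia.
have -> : W (- k%:Z) = - \sum_(i < k) w (Negz i).
  by case: k => [|k] //=; rewrite !big_ord0 oppr0.
by rewrite /= big_ord_recr /= opprK addKr.
Qed.

(** * Estimates for the increments of the coupling [W] *)

Section Increments.
Variables (k l : nat) (F : int -> 'M[R]_k) (G : int -> 'M[R]_l).
Variables (W : int -> 'M[R]_(k, l)) (c : R).
Hypothesis uF : forall n, F n \in unitmx.
Hypothesis uG : forall n, G n \in unitmx.
Hypothesis W_step : forall n, nrm (F n *m (W (n + 1) - W n) *m invmx (G n)) <= c.

Lemma step_bound_ge0 : 0 <= c.
Proof. exact: le_trans (nrm_ge0 _) (W_step 0). Qed.

(** Telescope into unit steps and insert [F] and [G] with their inverses around each: the middle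
    factor is bounded by [c], the outer ones by [f] and [g]. *)
Lemma increment_bound p q (X : 'M[R]_(p, k)) (Y : 'M[R]_(l, q)) n (t : nat)
    (f g : nat -> R) :
  (forall i, (i < t)%N -> nrm (X *m invmx (F (n + i%:Z))) <= f i) ->
  (forall i, (i < t)%N -> nrm (G (n + i%:Z) *m Y) <= g i) ->
  nrm (X *m (W (n + t%:Z) - W n) *m Y) <= \sum_(i < t) f i * c * g i.
Proof.
move=> hf hg.
have -> : W (n + t%:Z) - W n = \sum_(i < t) (W (n + i%:Z + 1) - W (n + i%:Z)).
  elim: t {hf hg} => [|t IH]; first by rewrite big_ord0 addr0 subrr.
  rewrite big_ord_recr /= -IH [RHS]addrC addrA subrK.
  by rewrite -addrA -PoszD addn1.
rewrite mulmx_sumr mulmx_suml; apply: le_trans (nrm_sum _) _.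
apply: ler_sum => i _; set w := W _ - _.
have -> : X *m w *m Y = X *m invmx (F (n + i%:Z)) *m
    (F (n + i%:Z) *m w *m invmx (G (n + i%:Z))) *m (G (n + i%:Z) *m Y).
  by rewrite !mulmxA !mulmxKV.
apply: nrmM_le (hg _ (ltn_ord i)); apply: nrmM_le (hf _ (ltn_ord i)) _.
exact: W_step.
Qed.

Variables (P : 'M[R]_k) (Q : 'M[R]_l) (K r s : R).
Hypothesis K0 : 0 <= K.
Hypothesis r0 : 0 <= r.
Hypothesis rs : r < s.
Hypothesis s1 : s < 1.
Hypothesis dF : decays TZ F P K r.

Let s0 : 0 <= s. Proof. by apply: ltW; apply: le_lt_trans rs. Qed.

(** In the [i]-th step [F] decays over the remaining [t - i] steps and [G] over the first [i]; since
    [r < s], the convolution keeps the rate [s]. *)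
Lemma stable_stable_bound n (t : nat) : Q *m Q = Q -> P *m P = P ->
  decays TZ G Q K s ->
  nrm (F (n + t%:Z) *m (P *m (W (n + t%:Z) - W n) *m Q) *m invmx (G n))
    <= K * c * K / (s - r) * s ^+ t.
Proof.
move=> QQ PP dG; rewrite !mulmxA -[_ *m Q *m _]mulmxA.
apply: le_trans (increment_bound (f := fun i => K * r ^+ (t - i))
  (g := fun i => K * s ^+ i) _ _) _ => [i it|i it|].
- have -> : n + t%:Z = n + i%:Z + (t - i)%N%:Z by lia.
  exact: dF.
- by rewrite mulmxA; apply: dG.
rewrite (eq_bigr (fun i : 'I_t => K * c * K * (r ^+ (t - i) * s ^+ i)));
  last by move=> i _; ring.
rewrite -mulr_sumr -[leRHS]mulrA [_^-1 * _]mulrC ler_wpM2l ?mulr_ge0 ?step_bound_ge0 //.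
exact: sum_geometric_le (ltW s1).
Qed.

Hypothesis F0 : F 0 = 1%:M.
Hypothesis G0 : G 0 = 1%:M.

(* [L] is the limit of [P W_n Q'] as [n -> -oo]. *)
Lemma stable_unstable_limit Q' : P *m P = P -> Q' *m Q' = Q' ->
  decays TZ (G \o -%R) Q' K s ->
  exists L c1, forall n,
    nrm (F n *m (P *m (W n - L) *m Q') *m invmx (G n)) <= c1.
Proof.
move=> PP Q'Q' dG.
(* The decay of [F] is weakened to the constant [K]; that of [G] in reversed time alone makes the
   sum bounded uniformly in [t]. *)
have back n (t : nat) :
    nrm (F n *m (P *m (W n - W (n - t%:Z)) *m Q') *m invmx (G n))
    <= K * c * K / (1 - s).
  rewrite !mulmxA -[_ *m Q' *m _]mulmxA -{2}(subrK t%:Z n).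
  apply: le_trans (increment_bound (f := fun=> K)
    (g := fun i => K * s ^+ (t - i)) _ _) _ => [i it|i it|].
  - have := @dF (n - t%:Z + i%:Z) (t - i)%N I I.
    have -> : n - t%:Z + i%:Z + (t - i)%N%:Z = n by lia.
    move/le_trans; apply; rewrite ler_piMr // exprn_ile1 //.
    by apply: ltW; apply: lt_trans s1.
  - have := dG (- n) (t - i)%N I I; rewrite /= opprK mulmxA.
    by have -> : - (- n + (t - i)%N%:Z) = n - t%:Z + i%:Z by lia.
  rewrite (eq_bigr (fun i : 'I_t => K * c * K * (s ^+ (t - i) * 1 ^+ i)));
    last by move=> i _; rewrite expr1n; ring.
  rewrite -mulr_sumr ler_wpM2l ?mulr_ge0 ?step_bound_ge0 //.
  by have := sum_geometric_le t s0 s1 (lexx 1); rewrite expr1n div1r.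
set c1 := K * c * K / (1 - s) in back.
have c10 : 0 <= c1 by apply: le_trans (back 0 0%N); apply: nrm_ge0.
pose u (N : nat) := P *m W (- N%:Z) *m Q'.
(* Carry the bound [back] from time [-N] to time 0: [F] costs at most [K], and [G] contributes
   [K * s ^+ N]. *)
have cauchy N t : nrm (u (N + t)%N - u N) <= K * c1 * K * s ^+ N.
  have -> : u (N + t)%N - u N = - ((P *m invmx (F (- N%:Z))) *m
      (F (- N%:Z) *m (P *m (W (- N%:Z) - W (- N%:Z - t%:Z)) *m Q')
        *m invmx (G (- N%:Z))) *m (G (- N%:Z) *m Q')).
    rewrite !mulmxA mulmxKV // mulmxKV // PP -[_ *m Q' *m Q']mulmxA Q'Q'.
    by rewrite mulmxBr mulmxBl opprB /u PoszD opprD.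
  rewrite nrmN -mulrA; apply: nrmM_le; first apply: nrmM_le (back _ _).
    have := @dF (- N%:Z) N I I; rewrite addNr F0 mul1mx => /le_trans; apply.
    rewrite ler_piMr // exprn_ile1 //.
    by apply: ltW; apply: lt_trans s1.
  by have := dG 0 N I I; rewrite /= add0r oppr0 G0 invmx1 mulmx1.
have [L hL] := mx_limit cauchy.
(* For fixed [n], a late enough [N] makes the error of replacing [L] by [u N] at most 1, even after
   conjugation at time [n]; [back] accounts for [c1]. Taking [N] at least the absolute value of [n]
   puts [-N] before [n]. *)
exists L, (c1 + 1) => n.
pose a := nrm (F n *m P) * ((k * l)%:R * (K * c1 * K)) * nrm (Q' *m invmx (G n)).
have s01 : 0 < s < 1 by rewrite s1 (le_lt_trans r0 rs).
have [N nN aN] := exists_small_pow a `|n|%N s01.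
have [t tE] : exists t : nat, - N%:Z = n - t%:Z by exists (absz (n + N%:Z)); lia.
have -> : P *m (W n - L) *m Q' =
    P *m (W n - W (- N%:Z)) *m Q' + P *m (u N - L) *m Q'.
  have uE : P *m u N *m Q' = P *m W (- N%:Z) *m Q'.
    by rewrite /u !mulmxA PP -[_ *m Q' *m Q']mulmxA Q'Q'.
  by rewrite !mulmxBr !mulmxBl uE addrA subrK.
rewrite mulmxDr mulmxDl; apply: le_trans (nrmD _ _) _; apply: lerD.
  by rewrite tE; apply: back.
rewrite !mulmxA -[_ *m Q' *m _]mulmxA; apply: le_trans aN.
apply: le_trans (nrmM_le (nrmM_le (lexx _) _) (lexx _)) _.
- by rewrite -opprB nrmN; apply: hL.
- by rewrite /a le_eqVlt; apply/orP; left; apply/eqP; ring.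
Qed.

End Increments.
End Estimates.

(** * Assembling a dichotomy of the block system from those of its diagonal *)

Section BlockDichotomy.
Variable R : realType.

Lemma block_conj k l (f : 'M[R]_k) (g : 'M[R]_l) (v L : 'M[R]_(k, l)) P Q
    (f' : 'M[R]_k) g' v' :
  f' \in unitmx -> g' \in unitmx ->
  block_mx f (f *m v) 0 g *m block_mx P L 0 Q
    *m invmx (block_mx f' (f' *m v') 0 g') =
  block_mx (f *m P *m invmx f') (f *m (L + v *m Q - P *m v') *m invmx g')
    0 (g *m Q *m invmx g').
Proof.
move=> uf ug; rewrite invmx_block // !mulmx_block !mul0mx !mulmx0 !addr0 !add0r.
rewrite !mul0mx add0r mulKmx // mulmxBr mulmxDr mulmxBl !mulmxDl mulmxN !mulmxA.
by rewrite addrC.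
Qed.

Lemma block_decays k l (F : int -> 'M[R]_k) (G : int -> 'M[R]_l)
    (W : int -> 'M[R]_(k, l)) P L1 L2 Q
    (c c1 c2 K r s : R) :
  (forall n, F n \in unitmx) -> (forall n, G n \in unitmx) ->
  (forall n, nrm (F n *m (W (n + 1) - W n) *m invmx (G n)) <= c) ->
  0 <= K -> 0 <= r -> r < s -> s < 1 -> P *m P = P -> Q *m Q = Q ->
  decays TZ F P K r -> decays TZ G Q K s ->
  (forall n, nrm (F n *m (P *m (W n - L1) *m (1%:M - Q)) *m invmx (G n)) <= c1) ->
  (forall n, nrm (F n *m ((1%:M - P) *m (W n - L2) *m Q) *m invmx (G n)) <= c2) ->
  decays TZ (fun n => block_mx (F n) (F n *m W n) 0 (G n))
    (block_mx P (P *m L1 *m (1%:M - Q) - (1%:M - P) *m L2 *m Q) 0 Q)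
    (K + K + (K * c * K / (s - r) + K * c1 + c2 * K)) s.
Proof.
move=> uF uG hW K0 r0 rs s1 PP QQ dF dG h1 h2 n t _ _.
have rsX : r ^+ t <= s ^+ t.
  by apply: lerXn2r; rewrite ?nnegrE ?(ltW rs) // ltW // (le_lt_trans r0).
have dFs : nrm (F (n + t%:Z) *m P *m invmx (F n)) <= K * s ^+ t.
  by apply: le_trans (dF n t I I) _; rewrite ler_wpM2l.
have c10 : 0 <= c1 by apply: le_trans (h1 0); apply: nrm_ge0.
rewrite block_conj // nrm_block.
set m := n + t%:Z in dFs *.
(* Three contributions: the increment of [W] between the two times, the deviation from [L1] at time
   [n] carried forward by [F] on the range of [P], and the deviation from [L2] at time [m] reached
   through [G] on the range of [Q]. *)
have -> : P *m L1 *m (1%:M - Q) - (1%:M - P) *m L2 *m Q + W m *m Q - P *m W n =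
    P *m (W m - W n) *m Q - P *m (P *m (W n - L1) *m (1%:M - Q))
    + (1%:M - P) *m (W m - L2) *m Q *m Q.
  rewrite -[_ *m Q *m Q]mulmxA QQ !mulmxA PP !mulmxBr !mulmxBl !mulmx1 !mul1mx.
  move: (P *m L1) (P *m L1 *m Q) (L2 *m Q) (P *m L2 *m Q) (W m *m Q) (P *m W n)
    (P *m W m *m Q) (P *m W n *m Q) => x1 x2 x3 x4 x5 x6 x7 x8.
  by apply/matrixP => i j; rewrite !mxE; ring.
have b1 := stable_stable_bound uF uG hW K0 r0 rs s1 dF n t QQ PP dG.
have b2 : nrm (F m *m (P *m (P *m (W n - L1) *m (1%:M - Q))) *m invmx (G n))
    <= K * s ^+ t * c1.
  rewrite (_ : _ *m invmx (G n) = F m *m P *m invmx (F n) *m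
    (F n *m (P *m (W n - L1) *m (1%:M - Q)) *m invmx (G n))).
    exact: nrmM_le dFs (h1 n).
  by rewrite !mulmxA mulmxKV.
have b3 : nrm (F m *m ((1%:M - P) *m (W m - L2) *m Q *m Q) *m invmx (G n))
    <= c2 * (K * s ^+ t).
  rewrite (_ : _ *m invmx (G n) = F m *m ((1%:M - P) *m (W m - L2) *m Q) *m
    invmx (G m) *m (G m *m Q *m invmx (G n))).
    exact: nrmM_le (h2 m) (dG n t I I).
  by rewrite !mulmxA mulmxKV.
have b4 := dG n t I I.
have n0 : nrm (0 : 'M[R]_(l, k)) = 0.
  by rewrite /nrm big1 // => i _; rewrite big1 // => j _; rewrite mxE normr0.
rewrite -/m in b1 b4 *; move: (P *m (W m - W n) *m Q) b1 => z1 b1.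
move: (P *m (P *m _ *m _)) b2 => z2 b2; move: (_ *m Q *m Q) b3 => z3 b3.
rewrite n0 mulmxDr mulmxBr mulmxDl mulmxBl.
have := nrmD (F m *m z1 *m invmx (G n) - F m *m z2 *m invmx (G n))
  (F m *m z3 *m invmx (G n)).
have := nrmD (F m *m z1 *m invmx (G n)) (- (F m *m z2 *m invmx (G n))).
rewrite nrmN; lra.
Qed.

(** The forward and backward estimates are two instances of [block_decays]. Each step of [W] is
    bounded at both of its end times because time reversal exchanges them. *)
Lemma dichotomy_block k l (F : int -> 'M[R]_k) (G : int -> 'M[R]_l)
    (W : int -> 'M[R]_(k, l)) P Q
    (c KP KQ r r' : R) :
  (forall n, F n \in unitmx) -> (forall n, G n \in unitmx) ->
  F 0 = 1%:M -> G 0 = 1%:M ->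
  (forall n, nrm (F n *m (W (n + 1) - W n) *m invmx (G n)) <= c) ->
  (forall n, nrm (F (n + 1) *m (W (n + 1) - W n) *m invmx (G (n + 1))) <= c) ->
  dichotomy TZ F P KP r -> dichotomy TZ G Q KQ r' ->
  exists PD K s,
    dichotomy TZ (fun n => block_mx (F n) (F n *m W n) 0 (G n)) PD K s.
Proof.
move=> uF uG F0 G0 hW hW' dP dQ.
have [K0P /andP[r0 r1] PP _ _] := dP.
have [K0Q /andP[r'0 r'1] QQ _ _] := dQ.
(* The midpoint between the larger rate and 1. The decay of [G] is weakened to [s], that of [F]
   stays at [r], which leaves the gap [r < s]. *)
pose K := KP + KQ; pose s := (1 + Num.max r r') / 2.
have rs : r < s by rewrite /s; case: (leP r r') => ?; lra.
have r's : r' < s by rewrite /s; case: (leP r r') => ?; lra.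
have s1 : s < 1 by rewrite /s; case: (leP r r') => ?; lra.
have K0 : 0 <= K by apply: addr_ge0.
have s0 : 0 < s by apply: lt_trans rs.
have weak p (T : int -> Prop) (H : int -> 'M[R]_p) Z (K1 K2 x y : R) :
    K1 <= K2 -> 0 <= K1 -> 0 < x -> x <= y ->
    decays T H Z K1 x -> decays T H Z K2 y.
  move=> K12 K10 x0 xy d n t Tn Tnt; apply: le_trans (d n t Tn Tnt) _.
  apply: ler_pM => //; first by rewrite exprn_ge0 // ltW.
  by apply: lerXn2r; rewrite ?nnegrE // ltW // (lt_le_trans x0).
have KPK : KP <= K by rewrite lerDl.
have KQK : KQ <= K by rewrite lerDr.
have [_ _ _ d1 d2] := dP; have [_ _ _ e1 e2] := dQ.
have {}d1 := weak _ _ _ _ _ _ _ _ KPK K0P r0 (lexx r) d1.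
have {}d2 := weak _ _ _ _ _ _ _ _ KPK K0P r0 (lexx r) d2.
have {}e1 := weak _ _ _ _ _ _ _ _ KQK K0Q r'0 (ltW r's) e1.
have {}e2 := weak _ _ _ _ _ _ _ _ KQK K0Q r'0 (ltW r's) e2.
have P'P' := idem_compl PP; have Q'Q' := idem_compl QQ.
pose Fr := F \o -%R; pose Gr := G \o -%R; pose Wr := W \o -%R.
have uFr n : Fr n \in unitmx by apply: uF.
have uGr n : Gr n \in unitmx by apply: uG.
have Fr0 : Fr 0 = 1%:M by rewrite /Fr /= oppr0.
have Gr0 : Gr 0 = 1%:M by rewrite /Gr /= oppr0.
have hWr n : nrm (Fr n *m (Wr (n + 1) - Wr n) *m invmx (Gr n)) <= c.
  have := hW' (- (n + 1)); have -> : - (n + 1) + 1 = - n by lia.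
  by rewrite -nrmN -mulNmx -mulmxN opprB.
have e1r : decays TZ (Gr \o -%R) Q K s.
  by move=> n t _ _; rewrite /= /Gr /= !opprK; apply: e1.
have [L1 [c1 h1]] :=
  stable_unstable_limit uF uG hW K0 (ltW r0) rs s1 d1 F0 G0 PP Q'Q' e2.
(* Reversing time turns the limit at [+oo] into one at [-oo], with [1 - P] and [Q] as the decaying
   projections. *)
have [L2 [c2 h2]] :=
  stable_unstable_limit uFr uGr hWr K0 (ltW r0) rs s1 d2 Fr0 Gr0 P'P' QQ e1r.
have h2' n : nrm (F n *m ((1%:M - P) *m (W n - L2) *m Q) *m invmx (G n)) <= c2.
  by have := h2 (- n); rewrite /Fr /Gr /Wr /= opprK.
have fwd := block_decays uF uG hW K0 (ltW r0) rs s1 PP QQ d1 e1 h1 h2'.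
have h1r n : nrm (Fr n *m ((1%:M - (1%:M - P)) *m (Wr n - L1) *m (1%:M - Q))
    *m invmx (Gr n)) <= c1.
  by rewrite subKr; apply: h1.
have h2r n : nrm (Fr n *m ((1%:M - P) *m (Wr n - L2) *m (1%:M - (1%:M - Q)))
    *m invmx (Gr n)) <= c2.
  by rewrite subKr; apply: h2.
(* With complementary projections and [L1], [L2] exchanged, the off-diagonal block changes sign,
   which yields exactly the complement of the projection in [fwd]. *)
have bwd := block_decays uFr uGr hWr K0 (ltW r0) rs s1 P'P' Q'Q' d2 e2 h2r h1r.
rewrite !subKr in bwd.
set Kf := K + K + _ in fwd; set Kb := K + K + _ in bwd.
have Kf0 : 0 <= Kf.
  by have := fwd 0 0%N I I; rewrite expr0 mulr1; apply: le_trans; apply: nrm_ge0.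
have Kb0 : 0 <= Kb.
  by have := bwd 0 0%N I I; rewrite expr0 mulr1; apply: le_trans; apply: nrm_ge0.
eexists _, (Kf + Kb), s; split; last 2 first.
- by apply: weak fwd; rewrite ?lerDl.
- by rewrite compl_block opprB; apply: weak bwd; rewrite ?lerDr.
- exact: addr_ge0.
- by rewrite s0 s1.
rewrite mulmx_block !mul0mx !mulmx0 !addr0 !add0r PP QQ; congr block_mx.
set X := P *m L1 *m _; set Y := _ *m L2 *m Q.
have PX : P *m X = X by rewrite /X !mulmxA PP.
have XQ : X *m Q = 0 by rewrite /X -mulmxA mulmxBl mul1mx QQ subrr mulmx0.
have PY : P *m Y = 0 by rewrite /Y !mulmxA mulmxBr mulmx1 PP subrr !mul0mx.
have YQ : Y *m Q = Y by rewrite /Y -[LHS]mulmxA QQ.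
by rewrite [P *m _]mulmxBr [_ *m Q]mulmxBl PX XQ PY YQ subr0 sub0r.
Qed.

End BlockDichotomy.

(** * Dichotomies of the block triangular system and of its diagonal parts *)

Section BlockSystem.
Variables (R : realType) (k l : nat).
Variables (A : int -> 'M[R]_k) (B : int -> 'M[R]_l) (C : int -> 'M[R]_(k, l)).
Hypothesis uA : forall n, A n \in unitmx.
Hypothesis uB : forall n, B n \in unitmx.

Let D n : 'M[R]_(k + l) := block_mx (A n) (C n) 0 (B n).
Let uD n : D n \in unitmx. Proof. exact: block_unitmx. Qed.

(** Variation of constants: [F n *m W n] solves the equation for [A] with forcing term
    [C n *m G n]. *)
Lemma block_fundamental : exists F G W,
  [/\ fundamental A F, fundamental B G,
      forall n, F (n + 1) *m (W (n + 1) - W n) = C n *m G n &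
      fundamental D (fun n => block_mx (F n) (F n *m W n) 0 (G n))].
Proof.
have [F fF] := fundamental_exists uA; have [G fG] := fundamental_exists uB.
have [V hV] := antidifference (fun n => invmx (F (n + 1)) *m (C n *m G n)).
have [F0 uF rF] := fF; have [G0 uG rG] := fG.
(* Normalized so that the block fundamental matrix is the identity at 0. *)
pose W n := V n - V 0.
have hW n : W (n + 1) - W n = invmx (F (n + 1)) *m (C n *m G n).
  by rewrite /W opprB addrA subrK hV.
exists F, G, W; split=> //; first by move=> n; rewrite hW mulKVmx.
split=> [|n|n]; first by rewrite F0 G0 /W subrr mulmx0 -scalar_mx_block.
  exact: block_unitmx.
rewrite mulmx_block !mulmx0 !mul0mx !addr0 add0r -rF -rG; congr block_mx.
have -> : W (n + 1) = W n + (W (n + 1) - W n) by rewrite [RHS]addrC subrK.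
by rewrite mulmxDr hW mulKVmx // mulmxA -rF.
Qed.

Lemma has_ED_block (a b c : R) :
  (forall n, nrm (invmx (A n)) <= a) -> (forall n, nrm (invmx (B n)) <= b) ->
  (forall n, nrm (C n) <= c) -> has_ED TZ A -> has_ED TZ B -> has_ED TZ D.
Proof.
move=> ha hb hc eA eB; have [F [G [W [fF fG hW fD]]]] := block_fundamental.
have [F0 uF rF] := fF; have [G0 uG rG] := fG.
have [P [KP [r dP]]] := (has_ED_dichotomy (T := TZ) I uA fF).1 eA.
have [Q [KQ [r' dQ]]] := (has_ED_dichotomy (T := TZ) I uB fG).1 eB.
apply: (has_ED_dichotomy (T := TZ) I uD fD).2.
have ac : 0 <= a * c.
  by rewrite mulr_ge0 // (le_trans (nrm_ge0 _) (ha 0), le_trans (nrm_ge0 _) (hc 0)).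
have cb : 0 <= c * b.
  by rewrite mulr_ge0 // (le_trans (nrm_ge0 _) (hb 0), le_trans (nrm_ge0 _) (hc 0)).
(* Conjugated at time [n], the increment of [W] is [invmx (A n) *m C n]; at time [n + 1] it is
   [C n *m invmx (B n)]. The constant covers both. *)
apply: (dichotomy_block (c := a * c + c * b)) dP dQ => // n.
  have -> : F n = invmx (A n) *m F (n + 1) by rewrite rF mulKmx.
  rewrite -[_ *m F _ *m _]mulmxA hW !mulmxA mulmxK //.
  by apply: le_trans (nrmM_le (ha n) (hc n)) _; rewrite lerDl.
rewrite hW; have -> : G n = invmx (B n) *m G (n + 1) by rewrite rG mulKmx.
rewrite !mulmxA mulmxK //.
by apply: le_trans (nrmM_le (hc n) (hb n)) _; rewrite lerDr.
Qed.

Lemma has_ED_diagonal : has_ED TZ D ->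
  [/\ has_ED TZge0 A, has_ED TZle0 A, has_ED TZge0 B & has_ED TZle0 B].
Proof.
move=> eD; have [F [G [W [fF fG _ fD]]]] := block_fundamental.
have [F0 uF _] := fF; have [G0 uG _] := fG; have [D0 _ _] := fD.
have [P [K [r dP]]] := (has_ED_dichotomy (T := TZ) I uD fD).1 eD.
have sub p T (H : int -> 'M[R]_p) Z (x y : R) :
    dichotomy TZ H Z x y -> dichotomy T H Z x y.
  by case=> ? ? ? d1 d2; split=> // n t _ _; [apply: d1|apply: d2].
have T0 : TZge0 0 by []. have T0' : TZle0 0 by [].
have [eA eB] := dichotomy_diag uF uG D0 (sub _ TZge0 _ _ _ _ dP).
(* The negative half-line is treated as the positive one of the time-reversed system, whose decaying
   projection is [1 - P]. *)
have [|[PA [KA [rA dA]]] [PB [KB [rB dB]]]] :=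
  @dichotomy_diag _ _ _ (F \o -%R) (G \o -%R) (fun n => F (- n) *m W (- n))
    (1%:M - P) K r (fun n => uF (- n)) (fun n => uG (- n)) _
    (sub _ TZge0 _ _ _ _ (dichotomy_rev dP)).
  by rewrite /= oppr0.
have TE : TZle0 \o -%R = TZge0.
  by apply/funext => n /=; rewrite /TZle0 /TZge0 oppr_le0.
split.
- exact: (has_ED_dichotomy T0 uA fF).2.
- apply: (has_ED_dichotomy T0' uA fF).2; exists (1%:M - PA), KA, rA.
  by apply: dichotomy_revK; rewrite TE.
- exact: (has_ED_dichotomy T0 uB fG).2.
- apply: (has_ED_dichotomy T0' uB fG).2; exists (1%:M - PB), KB, rB.
  by apply: dichotomy_revK; rewrite TE.
Qed.

End BlockSystem.

(** * Spectral shifts and the two inclusions *)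

Lemma bounded_seq_scale (R : realType) p q (a : R) (M : int -> 'M[R]_(p, q)) :
  bounded_seq M -> exists c, forall n, nrm (a *: M n) <= c.
Proof.
case=> c hc; exists (`|a| * ((p * q)%:R * c)) => n; rewrite nrmZ ler_wpM2l //.
by apply: le_trans (nrm_le_mxnorm _) _; rewrite ler_wpM2l.
Qed.

Theorem theorem3p2 (R : realType) (k d : nat) (hk1 : (1 <= k)%N) (hkd : (k < d)%N)
  (A : int -> 'M[R]_k) (B : int -> 'M[R]_(d - k)) (C : int -> 'M[R]_(k, d - k))
  (hA : lya_seq A) (hB : lya_seq B) (hC : bounded_seq C) :
  let D : int -> 'M[R]_(k + (d - k)) := fun n => block_mx (A n) (C n) 0 (B n) in
  ((SigmaPlus A `|` SigmaMinus A) `|` (SigmaPlus B `|` SigmaMinus B)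
     `<=` SigmaZ D) /\
  (SigmaZ D `<=` (SigmaZ A `|` SigmaZ B)).
Proof.
move=> D; have [_ [uA bA]] := hA; have [_ [uB bB]] := hB.
have e0 (g : R) : expR (- g) \is a GRing.unit by rewrite unitfE gt_eqF ?expR_gt0.
have uAg g n : expR (- g) *: A n \in unitmx by rewrite unitmxZ.
have uBg g n : expR (- g) *: B n \in unitmx by rewrite unitmxZ.
have DE g : (fun n => expR (- g) *: D n) = fun n =>
    block_mx (expR (- g) *: A n) (expR (- g) *: C n) 0 (expR (- g) *: B n).
  by apply/funext => n; rewrite scale_block_mx scaler0.
split=> g.
  rewrite /SigmaZ /Sigma_ED /= DE => h.
  move=> /(has_ED_diagonal (uAg g) (uBg g))[pA mA pB mB].
  by case: h => -[]; apply.
rewrite /SigmaZ /Sigma_ED /= DE => nD.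
have [eA|] := pselect (has_ED TZ (fun n => expR (- g) *: A n)); last by left.
right=> eB; apply: nD.
(* The inverses of the shifted matrices carry the reciprocal scalar. *)
have [a ha] := bounded_seq_scale (expR (- g))^-1 bA.
have [b hb] := bounded_seq_scale (expR (- g))^-1 bB.
have [c hc] := bounded_seq_scale (expR (- g)) hC.
by apply: (has_ED_block (uAg g) (uBg g) (a := a) (b := b) (c := c)) => // n;
  rewrite invmxZ.
Qed.
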